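(* Let $\mathcal{F}\subset\mathbb{C}$ be a field, $\theta_1,\dots,\theta_k$ a sequence of real numbers, and $\mathcal{P}=(\Pi_1,\dots,\Pi_s)$ a partition of $\{1,2,\dots,k\}$. Suppose there are polynomials $P_1,\dots,P_s\in\mathcal{F}[x]$, irreducible over $\mathcal{F}$, such that for each $1\le r\le s$ the set $\{\theta_j: j\in\Pi_r\}$ is exactly the set of (complex) roots of $P_r$. If for some $1\le r_1,r_2\le s$ $$\frac{\operatorname{Tr}(P_{r_1})}{\deg(P_{r_1})}\neq\frac{\operatorname{Tr}(P_{r_2})}{\deg(P_{r_2})},$$ then the partition $\mathcal{P}$ is non-degenerate.
   Context: $\operatorname{Tr}(P)$ denotes the sum of the roots of the polynomial $P$. For real $x$, $\|x\|=\min\{|x-n|:n\in\mathbb{Z}\}$. The partition $\mathcal{P}$ (with respect to $\theta_1,\dots,\theta_k$) is non-degenerate if there is a vector $(\rho_1,\dots,\rho_s)\in\mathbb{R}^s$, not constant mod 1 (not all $\rho_r$ congruent mod 1), such that for every $\varepsilon>0$ there is $t>0$ with $\|t\theta_j-\rho_r\|<\varepsilon$ for all $1\le r\le s$ and all $j\in\Pi_r$. *)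

(* Defs.v *)
From mathcomp Require Import all_boot all_order all_algebra.
From mathcomp Require Import classical_sets reals complex.
From mathcomp Require Import lra.
Set Implicit Arguments.
Unset Strict Implicit.
Unset Printing Implicit Defensive.
Import Order.TTheory GRing.Theory Num.Theory.
Local Open Scope ring_scope.
Local Open Scope complex_scope.

(* The infimum is attained: see [dist_int_min]. *)
Definition dist_int (R : realType) (x : R) : R :=
  inf [set `|x - n%:~R| | n in [set: int]]%classic.

Lemma dist_int_min (R : realType) (x : R) :
  (exists n : int, dist_int x = `|x - n%:~R|) /\
  (forall n : int, dist_int x <= `|x - n%:~R|).
Proof.
set A := [set `|x - n%:~R| | n in [set: int]]%classic.
have lbA : has_lbound A by exists 0 => _ [n _ <-].
have A0 : (A !=set0)%classic by exists `|x - 0%:~R|; exists 0.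
split; last by move=> n; apply: ge_inf => //; exists n.
pose f := Num.floor x.
have fl : f%:~R <= x by apply: floor_le.
have fs : x < (f + 1)%:~R by apply: floorD1_gt.
pose m : int :=
  if `|x - f%:~R| <= `|x - (f + 1)%:~R| then f else f + 1.
exists m; apply/le_anti/andP; split; first by apply: ge_inf => //; exists m.
apply: lb_le_inf => // _ [n _ <-].
have mf : `|x - m%:~R| <= `|x - f%:~R|.
  by rewrite /m; case: ifP => // /negbT; rewrite -ltNge => /ltW.
have mf1 : `|x - m%:~R| <= `|x - (f + 1)%:~R|.
  by rewrite /m; case: ifP.
have [nf|fn] := leP n f.
  apply: le_trans mf _.
  have nfR : n%:~R <= f%:~R :> R by rewrite ler_int.
  rewrite !ger0_norm; by [lra | rewrite subr_ge0; lra].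
apply: le_trans mf1 _.
have nfR : (f + 1)%:~R <= n%:~R :> R by rewrite ler_int lezD1.
rewrite !ler0_norm; by [lra | rewrite subr_le0; lra].
Qed.

(* The blocks are indexed, hence the injectivity requirement; [partition]
   already excludes empty blocks. *)
Definition ordered_partition (k s : nat) (Pi : 'I_s -> {set 'I_k}) : Prop :=
  finset.partition [set Pi r | r : 'I_s]%SET [set: 'I_k]%SET /\ injective Pi.

Definition constant_mod1 (R : realType) (s : nat) (rho : 'I_s -> R) : Prop :=
  forall r1 r2 : 'I_s, exists n : int, rho r1 - rho r2 = n%:~R.

Definition nondegenerate_partition (R : realType) (k s : nat) (theta : 'I_k -> R)
    (Pi : 'I_s -> {set 'I_k}) : Prop :=
  exists rho : 'I_s -> R, ~ constant_mod1 rho /\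
    forall eps : R, 0 < eps -> exists t : R, 0 < t /\
      forall (r : 'I_s) (j : 'I_k), j \in Pi r ->
        dist_int (t * theta j - rho r) < eps.

(* The complex roots of [p], listed with multiplicity, for [p != 0]. *)
Definition complex_roots (R : realType) (p : {poly R[i]}) : seq R[i] :=
  sval (closed_field_poly_normal p).

Definition to_complex (R : realType) (S : {pred R[i]}) (F : subFieldType S)
    (P : {poly F}) : {poly R[i]} := map_poly (val : F -> R[i]) P.

Definition Tr (R : realType) (S : {pred R[i]}) (F : subFieldType S)
    (P : {poly F}) : R[i] := \sum_(z <- complex_roots (to_complex P)) z.

Definition deg (R : nzRingType) (P : {poly R}) : nat := (size P).-1.

(* Main.v *)
Require Import Defs.
From mathcomp Require Import all_boot all_order all_algebra separable.
From mathcomp Require Import boolp reals complex trigo.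
From mathcomp Require Import ring lra.
Import Order.TTheory GRing.Theory Num.Theory.
Import Normc.
Local Open Scope ring_scope.
Local Open Scope complex_scope.

(** Write [tau r] for the mean [Tr (P r) / deg (P r)] of the roots of [P r].
    The witness of non-degeneracy is [rho r = c * tau r], where the real [c]
    is chosen so that two of the [rho r] differ by [1/2].

    That [t * theta j] can approach [rho r] modulo 1, simultaneously for all
    [r] and all [j] in [Pi r], is an instance of Kronecker's theorem
    ([kronecker_approximation]).  Its hypothesis is that every integer linear
    relation between the [theta j] is also satisfied by the targets, that is,
    that [\sum_j m j * theta j = 0] implies
    [\sum_j m j * tau (block j) = 0], where [j] is in [Pi (block j)].  This is
    where irreducibility enters:
    averaging the relation over the conjugates of the [theta j] replaces each
    [theta j] by the mean of the roots of its irreducible polynomial.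

    The averaging is the normalised trace of a finite extension
    ([conjugate_mean_linear]).  A primitive element [z] with minimal polynomial
    [Q] presents the field generated by the [theta j] as polynomials in the
    companion matrix [A] of [Q].  If [x = p(z)] is a root of an irreducible
    [P], then [P] annihilates [p(A)], so the characteristic polynomial of
    [p(A)] is a power of [P] up to a constant, and the normalised trace of
    [p(A)] is the mean of the roots of [P].

    Kronecker's theorem follows Bohr.  With [e] the character
    [x |-> exp(2 i pi x)], let [g t = 1 + \sum_j e(t * theta j - beta j)].
    Expanding [g ^+ p] over words of length [p] in the [#|J| + 1] terms of [g],
    words with the same frequency have the same phase because the relations
    are inherited by [beta], so they add up without cancellation.  There are at
    most polynomially many frequencies, hence some frequency collects
    [(#|J| + 1) ^ p] words up to a polynomial factor; the mean value that
    extracts this frequency is at most [sup |g| ^+ p], and letting [p] grow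
    gives [sup |g| >= #|J| + 1] ([bohr_bound]).  All summands of [g] can
    therefore be brought simultaneously close to the summand [1]. *)

Set Implicit Arguments.
Unset Strict Implicit.
Unset Printing Implicit Defensive.

(** * The character exp(2 i pi x) *)

Section Character.
Variable R : realType.
Implicit Types x y t : R.

Definition expi x : R[i] := cos (pi *+ 2 * x) +i* sin (pi *+ 2 * x).

Lemma expiD x y : expi (x + y) = expi x * expi y.
Proof.
apply/eqP; rewrite /expi mulrDr cosD sinD eq_complex /= eqxx /=.
by rewrite addrC mulrC [X in _ + X]mulrC [X in X + _]mulrC [X in _ + X]mulrC.
Qed.

Lemma expi0 : expi 0 = 1.
Proof. by rewrite /expi mulr0 cos0 sin0. Qed.

Lemma normc_expi x : normc (expi x) = 1.
Proof. by rewrite /normc /= cos2Dsin2 sqrtr1. Qed.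

Lemma expi_sum I (r : seq I) (f : I -> R) :
  expi (\sum_(i <- r) f i) = \prod_(i <- r) expi (f i).
Proof.
elim: r => [|i r IHr]; first by rewrite !big_nil expi0.
by rewrite !big_cons expiD IHr.
Qed.

Lemma expiMn x n : expi (x *+ n) = expi x ^+ n.
Proof. by elim: n => [|n IHn]; rewrite ?mulr0n ?expi0 // mulrS exprS expiD IHn. Qed.

Lemma expi_int (n : int) : expi n%:~R = 1.
Proof.
have expi1 : expi 1 = 1 by rewrite /expi mulr1 cos2pi sin2pi.
case: n => n; first by rewrite -[_%:~R]/(n%:R) expiMn expi1 expr1n.
rewrite NegzE mulrNz -[_%:~R]/(n.+1%:R); set m := n.+1.
have: expi (- m%:R) * expi m%:R = 1 by rewrite -expiD addNr expi0.
by rewrite [expi m%:R]expiMn expi1 expr1n mulr1.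
Qed.

Lemma cos2pi_abs x : cos (pi *+ 2 * x) = cos (pi *+ 2 * `|x|).
Proof.
by rewrite -cos_norm normrM (ger0_norm (mulrn_wge0 2 (pi_ge0 R))).
Qed.

Lemma cos2pi_mono x y : 0 <= x -> y <= 2^-1 ->
  x < y -> cos (pi *+ 2 * y) < cos (pi *+ 2 * x).
Proof.
move=> x0 y2 xy; have pi0 := pi_gt0 R.
have pi20: 0 < pi *+ 2 :> R by rewrite pmulrn_lgt0.
by rewrite ltr_cos ?ltr_pM2l ?in_itv //=; apply/andP; split; rewrite -mulr_natr; nra.
Qed.

Lemma cos2pi_le x y : 0 <= x -> x <= `|y| -> `|y| <= 2^-1 ->
  cos (pi *+ 2 * y) <= cos (pi *+ 2 * x).
Proof.
move=> x0 xy y2; rewrite cos2pi_abs.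
by move: xy; rewrite le_eqVlt => /orP[/eqP->//|xy]; apply/ltW/cos2pi_mono.
Qed.

Lemma cos2pi_lt1 x : 0 < `|x| -> `|x| < 1 -> cos (pi *+ 2 * x) < 1.
Proof.
rewrite cos2pi_abs; move: `|x| => {}x x0 x1.
rewrite -[ltRHS]cos0 -(mulr0 (pi *+ 2)).
have [x2|x2] := leP x 2^-1; first exact: cos2pi_mono.
have ->: cos (pi *+ 2 * x) = cos (pi *+ 2 * (1 - x)).
  by rewrite -[RHS]cosN mulrBr opprB mulr1 -[RHS]cosD2pi subrK.
by apply: cos2pi_mono => //; lra.
Qed.

Lemma expi_neq1 x : 0 < `|x| < 1 -> expi x != 1.
Proof.
case/andP=> x0 x1; apply/eqP => -[c1 _].
by have := cos2pi_lt1 x0 x1; rewrite c1 ltxx.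
Qed.

Lemma normc_ge0 (z : R[i]) : 0 <= normc z.
Proof. by case: z => a b; apply: sqrtr_ge0. Qed.

Lemma normc_sum I (r : seq I) (P : pred I) (f : I -> R[i]) :
  normc (\sum_(i <- r | P i) f i) <= \sum_(i <- r | P i) normc (f i).
Proof.
elim/big_rec2: _ => [|i y z _ yz]; first by rewrite normc0.
by rewrite (le_trans (le_normcD _ _)) // lerD2l.
Qed.

Lemma normcX (z : R[i]) n : normc (z ^+ n) = normc z ^+ n.
Proof. by elim: n => [|n IHn]; rewrite ?normc1 // !exprS normcM IHn. Qed.

(** * Kronecker's theorem *)

(** The bound is uniform in [T], so oscillating terms disappear from averages
    over arithmetic progressions. *)
Lemma geometric_expi_bound x y T : 0 < `|x| < 1 ->
  normc (\sum_(n < T) expi (x *+ n.+1 + y)) <= 2 / normc (expi x - 1).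
Proof.
move=> /expi_neq1 x1.
have nz: 0 < normc (expi x - 1).
  rewrite lt_def; apply/andP; split; last exact: normc_ge0.
  by apply: contraNneq x1 => /eq0_normc/eqP; rewrite subr_eq0.
have ->: \sum_(n < T) expi (x *+ n.+1 + y) = expi (x + y) * \sum_(n < T) expi x ^+ n.
  rewrite mulr_sumr; apply: eq_bigr => n _.
  by rewrite -expiMn -expiD mulrS addrAC.
rewrite normcM normc_expi mul1r ler_pdivlMr // mulrC -normcM -subrX1.
rewrite (le_trans (le_normcD _ _)) // normcN normcX normc_expi expr1n normc1.
exact: lexx.
Qed.

(** Averaging over [t = d, 2d, ..., Td] kills the nonzero frequencies as [T]
    grows, while each zero frequency contributes [1].  The step [d] is taken
    so small that [d * freq w] is never a nonzero integer. *)
Lemma zero_frequencies_le (W : finType) (freq phase : W -> R) (M : R) :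
    (forall w, freq w = 0 -> phase w = 0) ->
    (forall t, 0 < t -> normc (\sum_w expi (t * freq w + phase w)) <= M) ->
  #|[pred w | freq w == 0]|%:R <= M.
Proof.
move=> coherent bounded; set N := #|_|.
have D_gt0: 0 < 1 + \sum_w `|freq w| by rewrite ltr_wpDr ?sumr_ge0.
set d := (1 + \sum_w `|freq w|)^-1.
have d_gt0: 0 < d by rewrite invr_gt0.
have small w : freq w != 0 -> 0 < `|d * freq w| < 1.
  move=> w0; rewrite normrM (gtr0_norm d_gt0) mulr_gt0 ?normr_gt0 //= mulrC.
  rewrite ltr_pdivrMr // mul1r (bigD1 w) //= addrCA ltrDl ltr_wpDr //.
  exact: sumr_ge0.
pose C := \sum_(w | freq w != 0) 2 / normc (expi (d * freq w) - 1).
have key T : T%:R * N%:R <= T%:R * M + C.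
  pose S1 := \sum_(w | freq w == 0) \sum_(n < T) expi ((d * freq w) *+ n.+1 + phase w).
  pose S2 := \sum_(w | freq w != 0) \sum_(n < T) expi ((d * freq w) *+ n.+1 + phase w).
  have S1E: S1 = (T * N)%:R.
    rewrite /S1 (eq_bigr (fun=> T%:R)) => [|w /eqP w0].
      by rewrite (sumr_const [pred w | freq w == 0]) mulrnA.
    under eq_bigr do rewrite coherent // w0 mulr0 mul0rn addr0 expi0.
    by rewrite sumr_const card_ord.
  have S12: normc (S1 + S2) <= T%:R * M.
    have <-: \sum_w \sum_(n < T) expi ((d * freq w) *+ n.+1 + phase w) = S1 + S2.
      by rewrite (bigID (fun w => freq w == 0)).
    rewrite exchange_big (le_trans (normc_sum _ _ _)) //.
    rewrite mulr_natl -[T in _ *+ T]card_ord -sumr_const ler_sum // => n _.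
    under eq_bigr do rewrite -mulrnAl.
    by apply: bounded; rewrite pmulrn_lgt0.
  have S2_le: normc S2 <= C.
    rewrite /S2 (le_trans (normc_sum _ _ _)) // ler_sum // => w w0.
    exact/geometric_expi_bound/small.
  rewrite -natrM -[(T * N)%:R]/(_%:R); have <-: normc S1 = (T * N)%:R.
    by rewrite S1E normcMn normc1.
  rewrite -(addrK S2 S1) (le_trans (le_normcD _ _)) // normcN.
  exact: lerD.
rewrite leNgt; apply/negP => ltMN.
have := archi_boundP (_ : 0 <= `|C / (N%:R - M)|); set T := Num.bound _ => /(_ (normr_ge0 _)).
move=> /(le_lt_trans (ler_norm _)); rewrite ltr_pdivrMr ?subr_gt0 //.
by have := key T; lra.
Qed.

Lemma pigeonhole_fibre (W V : finType) (f : W -> V) (w1 : W) :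
  exists w0, (#|W| <= #|V| * #|[pred w | f w == f w0]|)%N.
Proof.
case: (@arg_maxnP W w1 predT (fun w0 => #|[pred w | f w == f w0]|) isT) => w0 _ max_w0.
exists w0; rewrite -sum1_card (partition_big f predT) //= -sum_nat_const leq_sum // => v _.
rewrite (sum1_card [pred w | f w == v]); have [w /= fw|no_w] := pickP [pred w | f w == v].
  move: fw => /= /eqP <-. exact: max_w0.
by rewrite eq_card0.
Qed.

Lemma bernoulli_le (h : R) n : 0 <= h -> 1 + n%:R * h <= (1 + h) ^+ n.
Proof.
move=> h0; elim: n => [|n IHn]; first by rewrite mul0r addr0.
have nh : 0 <= n%:R * h * h by rewrite !mulr_ge0.
rewrite exprSr; have : (1 + n%:R * h) * (1 + h) <= (1 + h) ^+ n * (1 + h).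
  by rewrite ler_wpM2r // addr_ge0.
by apply: le_trans; rewrite -natr1; lra.
Qed.

(** An exponential outgrows any polynomial: if [x = (1 + h) * y] with [h > 0],
    then for [p = 2 * n * k.+1] the square in [((1 + n * h) ^+ 2) ^+ k.+1]
    beats [p.+1 ^+ k.+1] as soon as [n * h ^+ 2] exceeds [2 * k.+1]. *)
Lemma exponential_base_le (x y : R) k : 0 <= x -> 0 <= y ->
  (forall p, x ^+ p <= p.+1%:R ^+ k * y ^+ p) -> x <= y.
Proof.
move=> x0 y0 growth; rewrite leNgt; apply/negP => ltyx.
move: y0; rewrite le_eqVlt => /orP[/eqP y0|y0].
  have := growth 1%N; rewrite -y0 !expr1 mulr0; lra.
have [h h0 Dx] : exists2 h, 0 < h & x = (1 + h) * y.
  exists (x / y - 1); first by rewrite subr_gt0 ltr_pdivlMr // mul1r.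
  by rewrite addrC subrK divfK // gt_eqF.
have [n n_large]: exists n, 2 * k.+1%:R < n%:R * h ^+ 2.
  exists (Num.bound (2 * k.+1%:R / h ^+ 2)); rewrite -ltr_pdivrMr ?exprn_gt0 //.
  apply: archi_boundP.
  by rewrite divr_ge0 ?mulr_ge0 ?exprn_ge0 // ltW.
have n0: 0 < n%:R :> R.
  rewrite lt_def ler0n andbT; apply/eqP => n0.
  by move: n_large; rewrite n0 mul0r ltNge mulr_ge0.
have lt_sq : 1 + n%:R * (2 * k.+1%:R) < (1 + n%:R * h) ^+ 2.
  have : n%:R * (2 * k.+1%:R) < n%:R * (n%:R * h ^+ 2) by rewrite ltr_pM2l.
  have := mulr_gt0 n0 h0; clear; move: (k.+1%:R) (n%:R) => K N; lra.
have le_sq : (1 + n%:R * h) ^+ 2 <= (1 + h) ^+ (n * 2).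
  rewrite exprM lerXn2r ?nnegrE ?exprn_ge0 ?bernoulli_le ?(ltW h0) //.
    by rewrite addr_ge0 // mulr_ge0 // ltW.
  by rewrite addr_ge0 // ltW.
have [p p1 Dp] : exists2 p, p.+1%:R = 1 + n%:R * (2 * k.+1%:R) :> R
    & (1 + h) ^+ p = ((1 + h) ^+ (n * 2)) ^+ k.+1.
  exists (n * (2 * k.+1))%N; last by rewrite mulnA exprM.
  by rewrite -(natr1 (n * _)) addrC natrM natrM.
have := growth p; rewrite Dx exprMn ler_pM2r ?exprn_gt0 // leNgt => /negP; apply.
apply: (@le_lt_trans _ _ (p.+1%:R ^+ k.+1)); first by rewrite ler_weXn2l // ler1n.
by rewrite Dp ltrXn2r // p1; apply: lt_le_trans le_sq.
Qed.

(** Bohr's argument: a sum of characters whose phases respect the additive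
    relations between the frequencies has supremum its number of terms.
    Grouping the words of length [p] by how often they use each letter gives
    at most [p.+1 ^ #|I|] classes, and each class has a single frequency. *)
Lemma bohr_bound (I : finType) (theta beta : I -> R) (G : R) : 0 <= G ->
    (forall p (w w' : {ffun 'I_p -> I}),
      \sum_i theta (w i) = \sum_i theta (w' i) -> \sum_i beta (w i) = \sum_i beta (w' i)) ->
    (forall t, 0 < t -> normc (\sum_i expi (t * theta i - beta i)) <= G) ->
  #|I|%:R <= G.
Proof.
move=> G0 coherent bounded; have [i0 _|noI] := pickP I; last by rewrite eq_card0.
apply: (@exponential_base_le _ _ #|I|) => // p.
pose count_letters (w : {ffun 'I_p -> I}) : {ffun I -> 'I_p.+1} :=
  [ffun j => inord #|[pred i | w i == j]|].
have [w0 le_w0] := pigeonhole_fibre count_letters [ffun=> i0].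
rewrite !card_ffun !card_ord in le_w0.
have sum_theta w : count_letters w = count_letters w0 ->
    \sum_i theta (w i) = \sum_i theta (w0 i).
  have by_letter (v : {ffun 'I_p -> I}) :
      \sum_i theta (v i) = \sum_j theta j *+ count_letters v j.
    rewrite (partition_big v predT) //=; apply: eq_bigr => j _.
    have le_p : (#|[pred i | v i == j]| < p.+1)%N.
      by rewrite ltnS -[leqRHS](card_ord p); apply: max_card.
    rewrite ffunE (inordK le_p).
    by rewrite -sumr_const; apply: eq_bigr => i /eqP->.
  by move=> eq_c; rewrite !by_letter eq_c.
(* Frequencies are taken relative to a word [w0] whose class is at least
   of average size. *)
pose freq (w : {ffun 'I_p -> I}) := \sum_i theta (w i) - \sum_i theta (w0 i).
pose phase (w : {ffun 'I_p -> I}) := \sum_i beta (w0 i) - \sum_i beta (w i).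
have: #|[pred w | freq w == 0]|%:R <= G ^+ p.
  apply: (@zero_frequencies_le _ freq phase) => [w /eqP|t t0].
    by rewrite subr_eq0 => /eqP/coherent eq_b; rewrite /phase eq_b subrr.
  have ->: \sum_w expi (t * freq w + phase w) =
      expi (\sum_i beta (w0 i) - t * \sum_i theta (w0 i)) *
        (\sum_i expi (t * theta i - beta i)) ^+ p.
    have expand (z : I -> R[i]) :
        (\sum_i z i) ^+ p = \sum_(w : {ffun 'I_p -> I}) \prod_i z (w i).
      by rewrite -[p in LHS]card_ord -prodr_const bigA_distr_bigA.
    rewrite expand mulr_sumr.
    apply: eq_bigr => w _; rewrite -expi_sum -expiD; congr expi.
    by rewrite sumrB -mulr_sumr /freq /phase; ring.
  rewrite normcM normc_expi mul1r normcX lerXn2r ?nnegrE ?bounded //.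
  exact: normc_ge0.
move=> leG; have le_pairs : (#|I| ^ p <= p.+1 ^ #|I| * #|[pred w | freq w == 0%R]|)%N.
  rewrite (leq_trans le_w0) // leq_mul2l; apply/orP; right.
  apply/subset_leq_card/subsetP => w; rewrite !inE => /eqP/sum_theta.
  by rewrite /freq => ->; rewrite subrr.
move: le_pairs; rewrite -(ler_nat R) natrM !natrX => /le_trans; apply.
by rewrite ler_wpM2l // exprn_ge0.
Qed.

Lemma dist_int_le_half x : dist_int x <= 2^-1.
Proof.
have [_ min_x] := dist_int_min x.
have := min_x (Num.floor x); have := min_x (Num.floor x + 1).
have := floor_le x; have := floorD1_gt x.
rewrite intrD; move: (Num.floor x)%:~R => f xf fx.
by rewrite ler0_norm ?ger0_norm; lra.
Qed.

Lemma dist_int_cos eps x : 0 <= eps -> eps <= dist_int x ->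
  cos (pi *+ 2 * x) <= cos (pi *+ 2 * eps).
Proof.
move=> eps0; have [[n Dn] _] := dist_int_min x; have := dist_int_le_half x.
rewrite Dn => half le_eps.
have ->: cos (pi *+ 2 * x) = cos (pi *+ 2 * (x - n%:~R)).
  have: expi x = expi (x - n%:~R) by rewrite -[in LHS](subrK n%:~R x) [LHS]expiD expi_int mulr1.
  by case.
exact: cos2pi_le.
Qed.

Lemma normc_1D_expi x : normc (1 + expi x) = Num.sqrt (2 + 2 * cos (pi *+ 2 * x)).
Proof.
rewrite /normc /=; congr Num.sqrt; have := cos2Dsin2 (pi *+ 2 * x).
move: (cos _) (sin _) => c d; rewrite add0r; lra.
Qed.

(** If the targets inherit the integer relations between the [theta j], then
    [t * theta j] approaches [beta j] modulo 1 simultaneously in [j].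
    Otherwise, for every [t > 0], some [1 + expi (t * theta j - beta j)] has
    modulus at most a constant [c < 2], which contradicts [bohr_bound].  The
    constant term [1], indexed by [None], is what fixes the common direction
    of the characters. *)
Lemma kronecker_approximation (J : finType) (theta beta : J -> R) :
    (forall m : J -> int, \sum_j theta j *~ m j = 0 -> \sum_j beta j *~ m j = 0) ->
  forall eps, 0 < eps -> exists t, 0 < t /\ forall j, dist_int (t * theta j - beta j) < eps.
Proof.
move=> coherent eps eps0; apply: contrapT => no_t.
have far t : 0 < t -> exists j, eps <= dist_int (t * theta j - beta j).
  move=> t0; apply: contrapT => no_j; apply: no_t; exists t; split=> // j.
  by rewrite ltNge; apply/negP => le_j; apply: no_j; exists j.
pose c := Num.sqrt (2 + 2 * cos (pi *+ 2 * eps)).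
have [j0 far1] := far 1 ltr01.
have eps_half: eps <= 2^-1 by apply: le_trans far1 (dist_int_le_half _).
have c2: c < 2.
  have cos1 : cos (pi *+ 2 * eps) < 1.
    by apply: cos2pi_lt1; rewrite gtr0_norm //; lra.
  have sq4 : 2 = Num.sqrt (2 ^+ 2) :> R by rewrite sqrtr_sqr ger0_norm.
  by rewrite [ltRHS]sq4 ltr_sqrt ?exprn_gt0 //; lra.
pose ext (f : J -> R) (o : option J) := if o is Some j then f j else 0.
pose G := c + #|J|%:R - 1.
have card_gt0: 1 <= #|J|%:R :> R by rewrite ler1n; apply/card_gt0P; exists j0.
have := @bohr_bound (option J) (ext theta) (ext beta) G.
rewrite card_option -natr1 /G => bohr.
suff: #|J|%:R + 1 <= c + #|J|%:R - 1 by lra.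
apply: bohr => [|p w w' eq_theta|t t0].
- by have := sqrtr_ge0 (2 + 2 * cos (pi *+ 2 * eps)); rewrite -/c; lra.
- pose m (v : {ffun 'I_p -> option J}) j := #|[pred i | v i == Some j]|.
  have by_letter (f : J -> R) (v : {ffun 'I_p -> option J}) :
      \sum_i ext f (v i) = \sum_j f j *+ m v j.
    have ext_sum o : ext f o = \sum_j (if o == Some j then f j else 0).
      rewrite -big_mkcond; case: o => [j|] /=; last by rewrite big_pred0.
      by rewrite (eq_bigl (pred1 j)) ?big_pred1_eq // => j'; apply: eq_sym.
    under eq_bigr do rewrite ext_sum.
    rewrite exchange_big; apply: eq_bigr => j _.
    by rewrite -big_mkcond (sumr_const [pred i | v i == Some j]).
  have diff f : \sum_i ext f (w i) - \sum_i ext f (w' i) =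
      \sum_j f j *~ (Posz (m w j) - Posz (m w' j)).
    by rewrite !by_letter -sumrB; apply: eq_bigr => j _; rewrite mulrzBr.
  by apply/eqP; rewrite -subr_eq0 diff coherent // -diff eq_theta subrr.
- have [j far_j] := far t t0.
  rewrite (bigD1 None) //= (bigD1 (Some j)) //= mulr0 subr0 expi0 addrA.
  apply: le_trans (le_normcD _ _) _; rewrite -addrA; apply: lerD.
    by rewrite normc_1D_expi ler_wsqrtr // lerD2l ler_pM2l // dist_int_cos // ltW.
  apply: le_trans (normc_sum _ _ _) _.
  under eq_bigr do rewrite normc_expi.
  have: \sum_(o : option J) (1 : R) = #|J|%:R + 1.
    by rewrite sumr_const card_option natr1.
  by rewrite (bigD1 None) //= (bigD1 (Some j)) //=; lra.
Qed.
End Character.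

(** * Means of conjugates *)

Section ConjugateMean.
Variables (F : fieldType) (L : closedFieldType) (iota : {rmorphism F -> L}).
Local Notation "p ^ f" := (map_poly f p) : ring_scope.

(** The roots of [q] in the closed field [L] detect a common factor with the
    irreducible [P], and [P] can be divided out until [q] is constant. *)
Lemma irreducible_power (P q : {poly F}) :
    irreducible_poly P -> q != 0 ->
    (forall z, root (q ^ iota) z -> root (P ^ iota) z) ->
  exists a (c : F), q = c *: P ^+ a.
Proof.
move=> irrP; have [n le_qn] := ubnP (size q).
elim: n q le_qn => // n IHn q le_qn q_neq0 rootq.
have [/size1_polyC->|q_gt1] := leqP (size q) 1.
  by exists 0, q`_0; rewrite expr0 alg_polyC.
have /closed_rootP[z qz] : size (q ^ iota) != 1 by rewrite size_map_poly gtn_eqF.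
have /dvdpP[r Dq]: P %| q.
  have: ~~ coprimep P q.
    apply/negP; rewrite -(coprimep_map iota) => /coprimep_root/(_ (rootq z qz)).
    by rewrite -rootE qz.
  case: irrP => _ irrP; rewrite /coprimep => /irrP/(_ (dvdp_gcdl _ _))/eqp_dvdl <-.
  exact: dvdp_gcdr.
have [r_neq0 P_neq0]: r != 0 /\ P != 0.
  by apply/andP; rewrite -negb_or -mulf_eq0 -Dq.
have [|||a [c Dr]] := IHn r; last 1 first.
- by exists a.+1, c; rewrite Dq Dr exprSr scalerAl.
- case: irrP => P_gt1 _; rewrite Dq size_mul // in le_qn.
  by move: le_qn P_gt1; case: (size P) => [|[|d]] //; rewrite addnS /= ltnS; 
    move=> le _; apply: leq_trans le; rewrite addnS ltnS leq_addr.
- done.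
- by move=> z' rz'; apply: rootq; rewrite Dq rmorphM /= rootM rz'.
Qed.

(** The eigenvalues of [B] are roots of [P], so its characteristic polynomial
    is a constant multiple of some [P ^+ a]: the eigenvalues are the entries of
    [s], each repeated [a] times, and [n.+1 = a * size s]. *)
Lemma trace_irreducible_annihilator n (B : 'M[F]_n.+1) (P : {poly F}) (s : seq L) :
    irreducible_poly P -> horner_mx B P = 0 ->
    P ^ iota = lead_coef (P ^ iota) *: \prod_(z <- s) ('X - z%:P) ->
    [pchar L] =i pred0 ->
  iota (\tr B) = n.+1%:R * ((\sum_(z <- s) z) / (size s)%:R).
Proof.
move=> irrP PB0 Ds char0.
have [P_gt1 _] := irrP; have P_neq0 : P != 0 by rewrite -size_poly_gt0 ltnW.
have rootB z : root ((char_poly B) ^ iota) z -> root (P ^ iota) z.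
  rewrite map_char_poly -root_mxminpoly.
  have dv: mxminpoly (map_mx iota B) %| P ^ iota.
    by apply: mxminpoly_min; rewrite -map_horner_mx PB0 map_mx0.
  by rewrite -!dvdp_XsubCl => /dvdp_trans; apply.
have [|a [c Dchi]] := irreducible_power irrP _ rootB.
  exact/monic_neq0/char_poly_monic.
pose ss := flatten (nseq a s).
have Dss: (char_poly B) ^ iota = \prod_(z <- ss) ('X - z%:P).
  have Dprod: \prod_(z <- ss) ('X - z%:P) = (\prod_(z <- s) ('X - z%:P)) ^+ a.
    rewrite /ss; elim: (a) => [|b IHb] /=; first by rewrite big_nil expr0.
    by rewrite big_cat IHb exprS.
  have mon: (char_poly B) ^ iota \is monic by rewrite map_monic char_poly_monic.
  rewrite Dprod; move: mon; rewrite Dchi linearZ rmorphXn /= Ds exprZn scalerA monicE.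
  rewrite lead_coefZ (monicP (monic_exp a (monic_prod_XsubC s predT id))) mulr1.
  by move/eqP->; rewrite scale1r.
have Dn: n.+1 = size ss.
  have /(congr1 (fun p : {poly L} => size p)) := Dss.
  by rewrite size_map_poly size_char_poly size_prod_XsubC => -[].
have s_neq0: (size s)%:R != 0 :> L.
  have := congr1 (fun p : {poly L} => size p) Ds.
  rewrite size_scale ?lead_coef_eq0 ?map_poly_eq0 //.
  rewrite size_map_poly size_prod_XsubC => szP.
  rewrite ((pcharf0P L).1 char0)//; apply: contraL P_gt1 => /eqP; rewrite szP => ->.
  by [].
have:= @coefPn_prod_XsubC _ ss; rewrite -Dn -Dss coef_map /= char_poly_trace //.
rewrite rmorphN => /(_ isT)/oppr_inj ->.
have ->: \sum_(p <- ss) p = a%:R * \sum_(z <- s) z.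
  rewrite /ss mulr_natl; elim: (a) => [|b IHb] /=; first by rewrite big_nil.
  by rewrite big_cat IHb mulrS.
have ->: n.+1%:R = a%:R * (size s)%:R :> L.
  rewrite Dn /ss -natrM; congr _%:R; rewrite size_flatten /shape map_nseq sumn_nseq.
  by rewrite mulnC.
by rewrite mulrACA mulfV ?mulr1 // -!mulrA.
Qed.

Lemma minimal_polynomial z : algebraicOver iota z ->
  exists2 q : {poly F}, q \is monic & forall p, root (p ^ iota) z = (q %| p).
Proof.
move=> [q0 q0_neq0 q0z].
pose A n := `[< exists2 q : {poly F}, q \is monic & root (q ^ iota) z /\ size q = n >].
have [|n /asboolP[q q_monic [qz sz_q]] min_n] := @ex_minnP A.
  exists (size q0); apply/asboolP; exists ((lead_coef q0)^-1 *: q0).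
    by rewrite monicE lead_coefZ mulVf ?lead_coef_eq0.
  by rewrite linearZ /= rootZ ?size_scale ?fmorph_eq0 ?invr_eq0 ?lead_coef_eq0.
exists q => // p; apply/idP/idP => [pz|/dvdpP[r ->]]; last first.
  by rewrite rmorphM rootM qz orbT.
rewrite /dvdp; apply/negPn/negP => r_neq0; set r := p %% q in r_neq0.
have rz: root (r ^ iota) z.
  move: pz; rewrite {1}(divp_eq p q) rmorphD rmorphM /= !rootE !hornerE.
  by rewrite (eqP qz) mulr0 add0r.
have/min_n: A (size r).
  apply/asboolP; exists ((lead_coef r)^-1 *: r).
    by rewrite monicE lead_coefZ mulVf ?lead_coef_eq0.
  by rewrite linearZ /= rootZ ?size_scale ?fmorph_eq0 ?invr_eq0 ?lead_coef_eq0.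
by rewrite leqNgt -sz_q ltn_modp monic_neq0.
Qed.

(** Adjoining the elements one at a time, each step is the primitive element
    theorem for two generators. *)
Lemma primitive_element (s : seq L) :
    [pchar F] =i pred0 -> (forall x, x \in s -> algebraicOver iota x) ->
  exists2 z, algebraicOver iota z & forall x, x \in s -> exists p, (p ^ iota).[z] = x.
Proof.
move=> char0; elim: s => [|x s IHs] alg_s; first by exists 0 => //; apply: algebraic0.
have [|z [p p_neq0 pz] genz] := IHs; first by move=> y sy; apply: alg_s; rewrite inE sy orbT.
have [q q_neq0 qx] := alg_s x (mem_head x s).
have [n [[pz' Dz] [px Dx]]] := pchar0_PET p_neq0 pz q_neq0 qx char0.
exists (x *+ n - z) => [|y].
  apply: algebraic_sub; last by exists p.
  rewrite -mulr_natr; apply: algebraic_mul; first by exists q.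
  by rewrite -(rmorph_nat iota); apply: algebraic_id.
rewrite inE => /orP[/eqP->|/genz[r <-]]; first by exists px.
by exists (r \Po pz'); rewrite map_comp_poly horner_comp Dz.
Qed.

Lemma horner_mx_comp n (A : 'M[F]_n.+1) (p q : {poly F}) :
  horner_mx A (p \Po q) = horner_mx (horner_mx A q) p.
Proof.
elim/poly_ind: p => [|p c IHp]; first by rewrite comp_poly0 !rmorph0.
by rewrite comp_poly_MXaddC !rmorphD !rmorphM /= IHp horner_mx_X !horner_mx_C.
Qed.

(** Replacing each [x i] by the mean of its conjugates preserves linear
    relations over [F]: it is the normalised trace of the extension generated
    by the [x i], computed on polynomials in a companion matrix. *)
Lemma conjugate_mean_linear (I : finType) (a : I -> F) (x : I -> L)
    (P : I -> {poly F}) (s : I -> seq L) :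
    [pchar L] =i pred0 ->
    (forall i, irreducible_poly (P i)) ->
    (forall i, root (P i ^ iota) (x i)) ->
    (forall i, P i ^ iota = lead_coef (P i ^ iota) *: \prod_(z <- s i) ('X - z%:P)) ->
    \sum_i iota (a i) * x i = 0 ->
  \sum_i iota (a i) * ((\sum_(z <- s i) z) / (size (s i))%:R) = 0.
Proof.
move=> char0 irrP Px Ds rel.
have charF0: [pchar F] =i pred0 by move=> p; rewrite -(fmorph_pchar iota).
have [|z /minimal_polynomial[Q Q_monic Qz] genz] := @primitive_element (codom x) charF0.
  move=> _ /codomP[i ->]; exists (P i) => //.
  by rewrite -size_poly_gt0 ltnW //; case: (irrP i).
have /fin_all_exists[p Dp] i : exists p, (p ^ iota).[z] = x i by apply/genz/codom_f.
have Q_gt1: (size Q > 1)%N.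
  have: root (Q ^ iota) z by rewrite Qz.
  rewrite -(size_map_poly iota); apply: root_size_gt1.
  by rewrite map_poly_eq0 monic_neq0.
(* [A] represents multiplication by [z] on [F(z)]; it is nonempty because
   [Q] is not constant. *)
have [n [A killA]]: exists n (A : 'M[F]_n.+1), horner_mx A Q = 0.
  have wlog_d d (B : 'M[F]_d) : (0 < d)%N -> char_poly B = Q ->
      exists n (A : 'M[F]_n.+1), horner_mx A Q = 0.
    by case: d B => // d B _ <-; exists d, B; apply: Cayley_Hamilton.
  by apply: wlog_d (companionmxK Q_monic); rewrite -subn1 subn_gt0.
have kill r : root (r ^ iota) z -> horner_mx A r = 0.
  by rewrite Qz => /dvdpP[r' ->]; rewrite rmorphM /= killA mulr0.
have: iota (\tr (horner_mx A (\sum_i a i *: p i))) = 0.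
  rewrite kill ?linear0 ?rmorph0 // rootE rmorph_sum horner_sum.
  rewrite -[X in _ == X]rel; apply/eqP/eq_bigr => i _.
  by rewrite /= map_polyZ hornerZ Dp.
rewrite !linear_sum /= rmorph_sum /= => sum0.
apply: (@mulfI _ n.+1%:R); first by rewrite ((pcharf0P L).1 char0).
rewrite mulr0 mulr_sumr -[RHS]sum0; apply: eq_bigr => i _.
rewrite linearZ /= linearZ /= rmorphM /= mulrCA; congr (_ * _).
symmetry; apply: trace_irreducible_annihilator (irrP i) _ (Ds i) char0.
by rewrite -horner_mx_comp kill // map_comp_poly rootE horner_comp Dp -rootE.
Qed.
End ConjugateMean.

(** * Non-degeneracy *)

Lemma ordered_partition_block (k s : nat) (Pi : 'I_s -> {set 'I_k}) : ordered_partition Pi ->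
  exists block : 'I_k -> 'I_s, forall r j, (j \in Pi r) = (block j == r).
Proof.
move=> [/and3P[/eqP cover_Pi triv_Pi _] inj_Pi].
have /fin_all_exists[block in_block] (j : 'I_k) : exists r, j \in Pi r.
  have : j \in cover [set Pi r | r : 'I_s] by rewrite cover_Pi inE.
  by move=> /bigcupP[_ /imsetP[r _ ->]]; exists r.
exists block => r j; apply/idP/eqP => [jr|<-//].
apply/inj_Pi/eqP; apply: contraT => neq.
have /disjointFr := trivIsetP triv_Pi _ _ (imset_f _ isT) (imset_f _ isT) neq.
by move/(_ _ (in_block j)); rewrite jr.
Qed.

Unset Implicit Arguments.
Set Strict Implicit.
Set Printing Implicit Defensive.

Theorem theorem2p11 (R : realType) (S : {pred R[i]}) (F : subFieldType S)
    (k s : nat) (theta : 'I_k -> R) (Pi : 'I_s -> {set 'I_k})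
    (hPi : ordered_partition Pi) (P : 'I_s -> {poly F})
    (P_irr : forall r : 'I_s, irreducible_poly (P r))
    (P_roots : forall (r : 'I_s) (z : R[i]),
      root (to_complex (P r)) z <-> exists2 j : 'I_k, j \in Pi r & z = (theta j)%:C)
    (hTr : exists r1 r2 : 'I_s,
      Tr (P r1) / (deg (P r1))%:R <> Tr (P r2) / (deg (P r2))%:R) :
  nondegenerate_partition theta Pi.
Proof.
have [block in_block] := ordered_partition_block hPi.
pose roots r := complex_roots (to_complex (P r)).
have P_neq0 r : P r != 0 by case: (P_irr r) => P_gt1 _; rewrite -size_poly_gt0 ltnW.
have Droots r : to_complex (P r) =
    lead_coef (to_complex (P r)) *: \prod_(z <- roots r) ('X - z%:P).
  exact: svalP (closed_field_poly_normal _).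
have lead_neq0 r : lead_coef (to_complex (P r)) != 0.
  by rewrite lead_coef_eq0 map_poly_eq0.
have Ddeg r : deg (P r) = size (roots r).
  have := congr1 (fun p : {poly R[i]} => size p) (Droots r).
  by rewrite size_scale // size_map_poly size_prod_XsubC /deg => ->.
pose mean r := Tr (P r) / (deg (P r))%:R.
have /fin_all_exists[tau Dtau] r : exists x : R, mean r = x%:C.
  apply/complex_realP; rewrite rpredM // ?rpredV ?realn //.
  rewrite /Tr big_seq rpred_sum // => z; rewrite -/(roots r) => root_z.
  have /P_roots[j _ ->] : root (to_complex (P r)) z.
    by rewrite Droots rootZ // root_prod_XsubC.
  by apply/complex_realP; exists (theta j).
have conj_rel (m : 'I_k -> int) : \sum_j theta j *~ m j = 0 ->
    \sum_j tau (block j) *~ m j = 0.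
  move=> rel; apply: (@complexI R); rewrite rmorph0 rmorph_sum /=.
  have conj := @conjugate_mean_linear F R[i] val 'I_k (fun j => (m j)%:~R)
    (fun j => (theta j)%:C) (fun j => P (block j)) (fun j => roots (block j)).
  have {conj} := conj (pchar_num _) (fun j => P_irr (block j)).
  have root_theta j : root (to_complex (P (block j))) (theta j)%:C.
    by apply/P_roots; exists j => //; rewrite in_block.
  move=> /(_ root_theta (fun j => Droots (block j))) conj.
  have cast (x : R) n : (x *~ n)%:C = val (n%:~R : F) * x%:C.
    by rewrite rmorphMz /= rmorph_int mulrzl.
  rewrite -[RHS]conj.
    by apply: eq_bigr => j _; rewrite cast -Dtau /mean Ddeg.
  transitivity ((\sum_j theta j *~ m j)%:C); last by rewrite rel.
  by rewrite rmorph_sum; apply: eq_bigr => j _; rewrite /= cast.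
case: hTr => r1 [r2 neq_tau].
have tau12 : tau r1 != tau r2.
  by apply/eqP => eq_tau; apply: neq_tau; rewrite -!/(mean _) !Dtau eq_tau.
(* With this [c], [c * (tau r1 - tau r2)] is [1/2]. *)
pose c := (2 * (tau r1 - tau r2))^-1.
exists (fun r => c * tau r); split.
  move=> /(_ r1 r2)[n]; rewrite -mulrBr /c invfM -mulrA mulVf ?subr_eq0 // mulr1 => half_int.
  have: (1 : R) = (n * 2)%:~R by rewrite intrM -half_int mulVf // pnatr_eq0.
  by move/(@intr_inj R 1)/(congr1 (fun i => i %% 2)%Z); rewrite modzMl.
move=> eps eps0.
have [m rel|t [t0 close]] :=
  @kronecker_approximation R _ theta (fun j => c * tau (block j)) _ eps eps0.
  rewrite (eq_bigr (fun j => c * (tau (block j) *~ m j))) => [|j _]; last by rewrite mulrzAr.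
  by rewrite -mulr_sumr conj_rel // mulr0.
exists t; split=> // r j; rewrite in_block => /eqP<-; exact: close.
Qed.
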